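(* Let $\{b_1(i,j), b_2(i,j)\}_{i,j\in\mathbb{Z}_{\ge 1}}$ be parameters in $[0,1]$, and assume there exist $I,J\in\mathbb{Z}_{\ge 1}$ such that $b_k(i+I,j)=b_k(i,j)$ and $b_k(i,j+J)=b_k(i,j)$ for all $i,j\in\mathbb{Z}_{\ge1}$ and $k\in\{1,2\}$. Let $h$ be the height function of the stochastic six vertex model on the first quadrant with these parameters and step initial data. Then there exists a (deterministic) Lipschitz function $g:\mathbb{R}_{\ge 0}^2\to\mathbb{R}$ such that with probability $1$, $$\lim_{n\to\infty}\frac{h(\lfloor nx\rfloor,\lfloor ny\rfloor)}{n}=g(x,y)\qquad\text{for all } x,y\in\mathbb{R}_{\ge 0}.$$
   Context: Stochastic six vertex (S6V) model with step initial data. The vertex set is $\mathbb{Z}_{\ge1}^2$. Each vertex $(i,j)$ has two input edges (bottom and left) and two output edges (top and right); the top edge of $(i,j)$ is the bottom edge of $(i,j+1)$ and the right edge of $(i,j)$ is the left edge of $(i+1,j)$. Each edge carries $0$ or $1$ line. Boundary data (step initial data): a line enters every vertex $(1,j)$, $j\ge1$, from the left, and no line enters any vertex $(i,1)$, $i\ge 1$, from the bottom. The vertices are processed sequentially in the order $(1,1),(2,1),(1,2),(3,1),(2,2),(1,3),\dots$. At vertex $(i,j)$, given its inputs, the outputs are sampled (conditionally independently of everything else sampled before) as follows: - both inputs occupied: both outputs occupied with probability $1$; - no input occupied: no output occupied with probability $1$; - only the bottom input occupied: only the top output is occupied with probability $b_1(i,j)$, only the right output is occupied with probability $1-b_1(i,j)$;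 - only the left input occupied: only the right output is occupied with probability $b_2(i,j)$, only the top output is occupied with probability $1-b_2(i,j)$. Viewing the occupied edges as a family of up-right paths, the height function $h$ on $\mathbb{Z}_{\ge0}^2$ records the number of lines to the right of $(x,y)$: explicitly, for $x\ge1$, $h(x,y)$ is the number of $j\in\{1,\dots,y\}$ such that the right output edge of $(x,j)$ is occupied, and $h(0,y)=y$. Equivalently, $h(x,y)=y-\#\{z\in\{1,\dots,x\}: \text{the top output edge of }(z,y)\text{ is occupied}\}$ for $y\ge1$, and $h(x,0)=0$. *)

(* Defs.v *)
From HB Require Import structures.
From mathcomp Require Export all_boot all_order all_algebra.
From mathcomp Require Export all_classical all_reals all_analysis.
Export Order.TTheory GRing.Theory Num.Theory.
Export numFieldNormedType.Exports.

Set Implicit Arguments.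
Unset Strict Implicit.
Unset Printing Implicit Defensive.

Local Open Scope classical_set_scope.
Local Open Scope ring_scope.

(* Conventions. Vertices are the pairs (i, j) with 1 <= i and 1 <= j.
   [top i j] and [right i j] tell whether the top and right output edges of
   the vertex (i, j) carry a line. The edges entering the quadrant are indexed
   in the same way: [top i 0] is the edge entering (i, 1) from the bottom and
   [right 0 j] the edge entering (1, j) from the left. Hence, for all
   vertices, the bottom input of (i, j) is [top i j.-1] and its left input is
   [right i.-1 j]. The values [top 0 j] and [right i 0] are never used. *)

(* Probability of the outputs [t] (top) and [r] (right) given the inputs
   [bot] and [lft]. *)
Definition s6v_weight (R : realType) (p1 p2 : R) (bot lft t r : bool) : R :=
  match bot, lft with
  | true, true => if t && r then 1 else 0
  | false, false => if ~~ t && ~~ r then 1 else 0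
  | true, false => match t, r with
                   | true, false => p1
                   | false, true => 1 - p1
                   | _, _ => 0
                   end
  | false, true => match t, r with
                   | false, true => p2
                   | true, false => 1 - p2
                   | _, _ => 0
                   end
  end.

(* (i', j') strictly precedes (i, j) in (1,1), (2,1), (1,2), (3,1), (2,2), ... *)
Definition s6v_before (i' j' i j : nat) : bool :=
  ((i' + j' < i + j) || ((i' + j' == i + j) && (j' < j)))%N.

Section StochasticSixVertex.
Context (R : realType) (d : measure_display) (T : measurableType d)
  (P : probability T R).

Implicit Types top right : nat -> nat -> {RV P >-> bool}.

(* The outputs of all vertices processed before (i, j) are those prescribed
   by the deterministic configuration [ct], [cr]. *)
Definition s6v_history top right (ct cr : nat -> nat -> bool) (i j : nat) :
    set T :=
  [set w | forall i' j', (0 < i')%N -> (0 < j')%N -> s6v_before i' j' i j ->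
             top i' j' w = ct i' j' /\ right i' j' w = cr i' j'].

Definition s6v_inputs top right (i j : nat) (bot lft : bool) : set T :=
  [set w | top i j.-1 w = bot /\ right i.-1 j w = lft].

Definition s6v_outputs top right (i j : nat) (t r : bool) : set T :=
  [set w | top i j w = t /\ right i j w = r].

(* [top] and [right] form a stochastic six vertex model with parameters [b1],
   [b2] and step initial data. The sampling rule is the conditional law of the
   outputs of a vertex given everything sampled before; the history takes
   finitely many values, so it is expressed by elementary conditioning,
   P(history, inputs, outputs) = P(history, inputs) * weight. *)
Definition stochastic_six_vertex (b1 b2 : nat -> nat -> R) top right : Prop :=
  [/\ forall j, (0 < j)%N -> forall w, right 0 j w = true,
      forall i, (0 < i)%N -> forall w, top i 0 w = false
    & forall i j, (0 < i)%N -> (0 < j)%N ->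
      forall (ct cr : nat -> nat -> bool) (bot lft t r : bool),
        P (s6v_history top right ct cr i j
             `&` s6v_inputs top right i j bot lft
             `&` s6v_outputs top right i j t r) =
        (P (s6v_history top right ct cr i j
              `&` s6v_inputs top right i j bot lft) *
         (s6v_weight (b1 i j) (b2 i j) bot lft t r)%:E)%E].

Definition s6v_height right (w : T) (x y : nat) : nat :=
  (if x is 0 then y else \sum_(1 <= j < y.+1) right x j w)%N.

End StochasticSixVertex.

(* Main.v *)
Require Import Defs.
From mathcomp Require Import all_boot all_order all_algebra.
From mathcomp Require Import all_classical all_reals all_analysis.
From mathcomp Require Import measurable_realfun zify ring lra.

Set Implicit Arguments.
Unset Strict Implicit.
Unset Printing Implicit Defensive.

Local Open Scope classical_set_scope.
Local Open Scope ring_scope.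

(** Attach to every vertex two independent bits: the first, of parameter [b1],
tells a lone line coming from below to go straight, the second, of parameter
[b2], tells a lone line coming from the left to go straight. The configuration
is a deterministic function of the bits, and the height function is subadditive
for every choice of the bits [u]:

  h_u (X + x, Y + y) <= h_u (X, Y) + h_(u shifted by (X, Y)) (x, y).

This is [height_subadd]. With fixed bits, adding incoming lines can only add
lines everywhere. The quadrant above (X, Y) has fewer lines entering from the
left than a step boundary, and possibly some entering from below. A line added
on the left can only increase the number of lines that leave on the right. A
line added below increases by one the number of lines entering below, and
adds at most one line on the right, so that the difference of the two numbers
cannot increase.

When (X, Y) is a period of the parameters, the second summand is independent of
the first one and has the law of h (x, y). So the means are subadditive, and
the second moments s and means a of h at (X, Y) and (2 X, 2 Y) satisfy
s' <= 2 s + 2 a ^ 2. This is the situation of Hammersley's and Kesten's law of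
large numbers for subadditive families of distributions. With V_k and A_k the
variance and the squared mean of h at (2 ^ k X, 2 ^ k Y), both divided by 4 ^ k,
the inequality reads V_(k + 1) + A_(k + 1) <= V_k / 2 + A_k. Summation bounds the
series of the V_k ([sum_of_halving_le]), so the squares of the centred heights
divided by 2 ^ k have a sum of finite mean, and the centred heights divided by
2 ^ k converge almost surely to 0 along every dyadic ray
([ae_cvg0_of_sum_second_moments]).

What remains is deterministic. Since, almost surely, h moves by at most 1 between
neighbours, as does its mean, and since at each scale finitely many dyadic rays come close
to all the points to be considered, the centred heights are o(n) at
(floor (n x), floor (n y)), for all x and y at once ([dyadic_interpolation]).
The mean at these points is subadditive in n up to a bounded error, and Fekete's
lemma gives its limit g ([scaling_limit_cvg]), which inherits the Lipschitz
bound.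

The space on which the model lives carries no bits: only conditional
probabilities of edges are given. This suffices, because the argument uses
expectations of functions of finitely many edges. Those are computed by
following the order in which the vertices are sampled, and agree with finite
weighted sums over the bits ([integral_sample_box]). *)

(** * Configurations driven by bits *)

(** Outputs (top, right) of a vertex. The bits [b.1] and [b.2] are read by a lone
bottom line and by a lone left line; [true] means going straight. *)
Definition vertex_rule (b : bool * bool) (bot lft : bool) : bool * bool :=
  match bot, lft with
  | true, true => (true, true)
  | false, false => (false, false)
  | true, false => (b.1, ~~ b.1)
  | false, true => (~~ b.2, b.2)
  end.

(** The boundary of [c] is left free here, as the comparisons below involve
configurations that share their bits and differ on the boundary. *)
Definition obeys (u c : nat -> nat -> bool * bool) : Prop :=
  forall i j, c i.+1 j.+1 = vertex_rule (u i.+1 j.+1) (c i.+1 j).1 (c i j.+1).2.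

Fixpoint config_row (u : nat -> bool * bool) (bot : nat -> bool) (l : bool)
    (i : nat) : bool * bool :=
  if i is i'.+1 then vertex_rule (u i) (bot i) (config_row u bot l i').2
  else (false, l).

(** The right component of row 0 and the top component of column 0 are not edges
of the model. Their values make the whole boundary of a step configuration
equal to [(false, true)]. *)
Fixpoint config_rows (u : nat -> nat -> bool * bool) (l b : nat -> bool)
    (j : nat) : nat -> bool * bool :=
  if j is j'.+1
  then config_row (u^~ j) (fun i => (config_rows u l b j' i).1) (l j)
  else fun i => (b i, true).

Definition config_of (u : nat -> nat -> bool * bool) (l b : nat -> bool)
    (i j : nat) : bool * bool := config_rows u l b j i.

Definition step_config (u : nat -> nat -> bool * bool) :=
  config_of u (fun=> true) (fun=> false).

Definition height (c : nat -> nat -> bool * bool) (x y : nat) : nat :=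
  (\sum_(j < y) (c x j.+1).2)%N.

Definition shift (X Y : nat) A (c : nat -> nat -> A) (i j : nat) : A :=
  c (X + i)%N (Y + j)%N.

Lemma config_ofP u l b : obeys u (config_of u l b).
Proof. by []. Qed.

Lemma obeys_shift X Y u c : obeys u c -> obeys (shift X Y u) (shift X Y c).
Proof. by move=> h i j; rewrite /shift !addnS h. Qed.

Lemma vertex_rule_conserve b bot lft :
  ((vertex_rule b bot lft).1 + (vertex_rule b bot lft).2 = bot + lft)%N.
Proof. by case: b bot lft => [[] []] [] []. Qed.

(** Two ordered pairs of inputs that differ have a pair without a choice among
them, either empty or full, and such a pair compares with every outcome of the
other. *)
Lemma vertex_rule_mono b bot lft bot' lft' : bot ==> bot' -> lft ==> lft' ->
  (((vertex_rule b bot lft).1 ==> (vertex_rule b bot' lft').1) &&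
   ((vertex_rule b bot lft).2 ==> (vertex_rule b bot' lft').2)).
Proof. by case: b bot lft bot' lft' => [[] []] [] [] [] []. Qed.

Lemma height_col u c x y : obeys u c ->
  (height c x.+1 y + (c x.+1 y).1 = height c x y + (c x.+1 0).1)%N.
Proof.
move=> h; elim: y => [|y IH]; rewrite /height ?big_ord0 //.
rewrite !big_ord_recr /= -!/(height c _ _).
have := vertex_rule_conserve (u x.+1 y.+1) (c x.+1 y).1 (c x y.+1).2.
rewrite -h => e; lia.
Qed.

Lemma height_conserve u c x y : obeys u c ->
  (height c x y + \sum_(i < x) (c i.+1 y).1 =
   height c 0 y + \sum_(i < x) (c i.+1 0).1)%N.
Proof.
move=> h; elim: x => [|x /= IH]; first by rewrite !big_ord0.
rewrite !big_ord_recr /=; have e := height_col x y h; lia.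
Qed.

Lemma obeys_mono u c c' : obeys u c -> obeys u c' ->
  (forall j, (c 0 j.+1).2 ==> (c' 0 j.+1).2) ->
  (forall i, (c i.+1 0).1 ==> (c' i.+1 0).1) ->
  forall j i, ((c i.+1 j).1 ==> (c' i.+1 j).1) && ((c i j.+1).2 ==> (c' i j.+1).2).
Proof.
move=> h h' hl hb.
have right_row j : (forall i, (c i.+1 j).1 ==> (c' i.+1 j).1) ->
    forall i, (c i j.+1).2 ==> (c' i j.+1).2.
  move=> hj; elim=> [|i IH]; first exact: hl.
  by rewrite h h'; have /andP[] := vertex_rule_mono (u i.+1 j.+1) (hj i) IH.
suff top_row j i : (c i.+1 j).1 ==> (c' i.+1 j).1.
  by move=> j i; rewrite top_row right_row.
elim: j i => [|j IH] i; first exact: hb.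
rewrite h h'.
by have /andP[] := vertex_rule_mono (u i.+1 j.+1) (IH i) (right_row j IH i).
Qed.

(** Passing to the step boundary in two moves: emptying the bottom boundary, then
filling the left one. The second move only adds lines on the right. The first
one adds no line at the top, so that by conservation it removes at most as many
lines on the right as it does below. *)
Lemma height_le_step u c x y : obeys u c ->
  (height c x y <= height (step_config u) x y + \sum_(i < x) (c i.+1 0).1)%N.
Proof.
move=> h.
(* [e] has the left boundary of [c] and an empty bottom boundary. *)
pose e := config_of u (fun j => (c 0 j).2) (fun=> false).
have he : obeys u e := config_ofP _ _ _.
have ec := @obeys_mono u e c he h (fun j => implybb _) (fun=> isT).
have es := @obeys_mono u e (step_config u) he (config_ofP _ _ _)
  (fun j => implybT _) (fun=> isT).
have h1 : (height e x y <= height (step_config u) x y)%N.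
  by apply: leq_sum => j _; have /andP[_] := es j x; do 2!case: (_.2).
have h2 : (\sum_(i < x) (e i.+1 y).1 <= \sum_(i < x) (c i.+1 y).1)%N.
  by apply: leq_sum => i _; have /andP[+ _] := ec y i; do 2!case: (_.1).
have := height_conserve x y h; have := height_conserve x y he.
have -> : height e 0 y = height c 0 y by [].
rewrite [X in _ = (_ + X)%N]big1 //; lia.
Qed.

(** Seen from (X, Y), the configuration obeys the shifted bits. The lines counted
by the height at (X, Y) either cross column X + x at height at most Y or enter
the upper quadrant from below in one of the x columns in between; the latter are
the correction term of [height_le_step]. *)
Lemma height_subadd u X Y x y :
  (height (step_config u) (X + x) (Y + y) <=
   height (step_config u) X Y + height (step_config (shift X Y u)) x y)%N.
Proof.
set c := step_config u.
have hc : obeys u c := config_ofP _ _ _.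
have := height_le_step x y (obeys_shift X Y hc).
have := height_conserve x Y (obeys_shift X 0 hc).
rewrite [X in _ = (_ + X)%N -> _]big1 // addn0.
have -> : height c (X + x) (Y + y) = (height c (X + x) Y + height (shift X Y c) x y)%N.
  rewrite /height big_split_ord /=; congr (_ + _)%N.
  by apply: eq_bigr => j _; rewrite /shift addnS.
have -> : height (shift X 0 c) x Y = height c (X + x) Y by [].
have -> : height (shift X 0 c) 0 Y = height c X Y by rewrite /height /shift addn0.
have -> : (\sum_(i < x) (shift X Y c i.+1 0).1 = \sum_(i < x) (shift X 0 c i.+1 Y).1)%N.
  by apply: eq_bigr => i _; rewrite /shift addn0.
lia.
Qed.

Lemma step_height_lipx u x y :
  (height (step_config u) x.+1 y <= height (step_config u) x y <=
   (height (step_config u) x.+1 y).+1)%N.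
Proof.
have := height_col x y (config_ofP u (fun=> true) (fun=> false)).
rewrite -/(step_config u) /= addn0.
by case: (step_config u x.+1 y).1; lia.
Qed.

Lemma height_lipy c x y : (height c x y <= height c x y.+1 <= (height c x y).+1)%N.
Proof.
by rewrite /height big_ord_recr /= leq_addr -[in leqRHS]addn1 leq_add2l; case: (_.2).
Qed.

Lemma step_config_local u u' x y :
  (forall i j, (0 < i <= x)%N -> (0 < j <= y)%N -> u i j = u' i j) ->
  forall i j, (i <= x)%N -> (j <= y)%N -> step_config u i j = step_config u' i j.
Proof.
move=> h i j; elim: j i => [|j IHj] i; first by [].
elim: i => [|i IHi] hi hj; first by [].
have E v : step_config v i.+1 j.+1 = vertex_rule (v i.+1 j.+1)
   (step_config v i.+1 j).1 (step_config v i j.+1).2 by [].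
by rewrite !E IHj ?IHi ?h //; lia.
Qed.

Lemma step_height_local u u' x y :
  (forall i j, (0 < i <= x)%N -> (0 < j <= y)%N -> u i j = u' i j) ->
  height (step_config u) x y = height (step_config u') x y.
Proof.
by move=> h; apply: eq_bigr => j _; rewrite (step_config_local h) //; lia.
Qed.

(** * Expectation over finitely many labels *)

Section FiniteExpectation.
Context (R : realDomainType) (B : finType).
Implicit Types (w : nat * nat -> B -> R) (u : nat -> nat -> B)
  (phi psi : (nat -> nat -> B) -> R) (s : seq (nat * nat)) (v : nat * nat).

Definition set_label u v (b : B) (i j : nat) : B :=
  if (i, j) == v then b else u i j.

(** Integrates the labels of the vertices of [s], from left to right, and keeps
those of [u] at the other vertices. The recursion on a list allows the order of
sampling to be followed, and different finite sets of vertices to be compared. *)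
Fixpoint expect w s phi u : R :=
  if s is v :: s' then \sum_b w v b * expect w s' phi (set_label u v b)
  else phi u.

Definition depends_on (A : pred (nat * nat)) phi : Prop :=
  forall u u', (forall i j, A (i, j) -> u i j = u' i j) -> phi u = phi u'.

Lemma set_labelC u v v' b b' : v != v' ->
  set_label (set_label u v b) v' b' = set_label (set_label u v' b') v b.
Proof.
move=> vv'; apply/funext => i; apply/funext => j; rewrite /set_label.
by case: eqVneq => // ->; rewrite eq_sym (negPf vv').
Qed.

Lemma set_label_shift u X Y v b :
  shift X Y (set_label u (X + v.1, Y + v.2)%N b) = set_label (shift X Y u) v b.
Proof.
apply/funext => i; apply/funext => j; rewrite /shift /set_label.
by case: v => v1 v2; rewrite !xpair_eqE !eqn_add2l.
Qed.

Lemma expect_cat w s s' phi u :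
  expect w (s ++ s') phi u = expect w s (expect w s' phi) u.
Proof. by elim: s u => //= v s IH u; apply: eq_bigr => b _; rewrite IH. Qed.

Lemma eq_expect w s phi psi u : phi =1 psi -> expect w s phi u = expect w s psi u.
Proof. by move=> /funext ->. Qed.

Lemma expectD w s phi psi u :
  expect w s (fun u => phi u + psi u) u = expect w s phi u + expect w s psi u.
Proof.
elim: s u => //= v s IH u; rewrite -big_split /=.
by apply: eq_bigr => b _; rewrite IH mulrDr.
Qed.

Lemma expectZ w s a phi u :
  expect w s (fun u => a * phi u) u = a * expect w s phi u.
Proof.
elim: s u => //= v s IH u; rewrite mulr_sumr.
by apply: eq_bigr => b _; rewrite IH mulrCA.
Qed.

Lemma le_expect w s phi psi u : (forall v b, v \in s -> 0 <= w v b) ->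
  (forall u, phi u <= psi u) -> expect w s phi u <= expect w s psi u.
Proof.
move=> w0 le; elim: s u w0 => //= v s IH u w0.
apply: ler_sum => b _; apply: ler_wpM2l; first by rewrite w0 ?mem_head.
by apply: IH => v' b' v's; rewrite w0 // inE v's orbT.
Qed.

Lemma expect_depends_on w s A phi :
  depends_on A phi -> depends_on A (expect w s phi).
Proof.
move=> dep; elim: s => //= v s IH u u' h.
apply: eq_bigr => b _; congr (_ * _); apply: IH => i j Aij.
by rewrite /set_label h.
Qed.

Lemma depends_on_set_label A phi u v b :
  depends_on A phi -> ~~ A v -> phi (set_label u v b) = phi u.
Proof.
move=> dep nA; apply: dep => i j Aij; rewrite /set_label.
by case: eqP => // e; rewrite -e Aij in nA.
Qed.

Context (w : nat * nat -> B -> R) (w1 : forall v, \sum_b w v b = 1).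

(** From here on the weights of each vertex sum to 1: labels on which the integrand
does not depend can be integrated out. *)
Lemma expect_id s A phi u : depends_on A phi -> {in s, forall v, ~~ A v} ->
  expect w s phi u = phi u.
Proof.
move=> dep; elim: s u => //= v s IH u nA.
under eq_bigr => b _.
  rewrite IH ?(depends_on_set_label _ _ dep) ?nA ?mem_head //; last first.
    by move=> v' v's; rewrite nA // inE v's orbT.
  over.
by rewrite -mulr_suml w1 mul1r.
Qed.

Lemma expect_cst s a u : expect w s (fun=> a) u = a.
Proof. by rewrite (@expect_id _ pred0). Qed.

(** The vertex sampled first belongs to [A] or not; in each case one of the two
factors does not depend on its label and leaves the sum. *)
Lemma expect_indep s A phi psi u : depends_on A phi ->
  depends_on (predC A) psi ->
  expect w s (fun u => phi u * psi u) u = expect w s phi u * expect w s psi u.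
Proof.
move=> dphi dpsi; elim: s u => //= v s IH u.
have phis := expect_depends_on w s dphi.
have psis := expect_depends_on w s dpsi.
under eq_bigr do rewrite IH mulrA.
have drop chi D : depends_on D chi -> ~~ D v ->
    \sum_b w v b * chi (set_label u v b) = chi u.
  move=> dchi nD; under eq_bigr do rewrite (depends_on_set_label _ _ dchi nD).
  by rewrite -mulr_suml w1 mul1r.
have [Av|nAv] := boolP (A v).
  have nDv : ~~ predC A v by rewrite /= Av.
  rewrite (drop _ _ psis nDv) mulr_suml; apply: eq_bigr => b _.
  by rewrite (depends_on_set_label _ _ psis nDv).
rewrite (drop _ _ phis nAv) mulr_sumr; apply: eq_bigr => b _.
by rewrite (depends_on_set_label _ _ phis nAv) mulrAC mulrC.
Qed.

Lemma expect_swap v v' phi u :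
  expect w [:: v; v'] phi u = expect w [:: v'; v] phi u.
Proof.
have [->//|vv'] := eqVneq v v'; rewrite /=.
under eq_bigr do rewrite mulr_sumr.
under [in RHS]eq_bigr do rewrite mulr_sumr.
rewrite exchange_big /=; apply: eq_bigr => b _; apply: eq_bigr => b' _.
by rewrite set_labelC // mulrCA.
Qed.

Lemma expect_perm s s' phi u : perm_eq s s' ->
  expect w s phi u = expect w s' phi u.
Proof.
have front v t t' psi u' :
    expect w (t ++ v :: t') psi u' = expect w (v :: t ++ t') psi u'.
  elim: t u' => //= v' t IH u'; under eq_bigr do rewrite IH.
  by have := expect_swap v' v (expect w (t ++ t') psi) u'.
elim: s s' u => [|v s IH] s' u ss'.
  by rewrite perm_sym in ss'; rewrite (perm_nilP ss').
have vs' : v \in s' by rewrite -(perm_mem ss') mem_head.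
case/splitPr: vs' ss' => t t'; rewrite perm_sym -cat1s perm_catCA /= perm_cons => st.
by rewrite front /=; apply: eq_bigr => b _; rewrite (IH (t ++ t')) // perm_sym.
Qed.

(** The set of integrated vertices is irrelevant as long as it contains those on
which the integrand depends: the others are moved to the end of the list. *)
Lemma expect_sub s s' phi u : depends_on (mem s') phi -> uniq s -> uniq s' ->
  {subset s' <= s} -> expect w s phi u = expect w s' phi u.
Proof.
move=> dep us us' sub.
have /(@expect_perm s) -> : perm_eq s (s' ++ [seq v <- s | v \notin s']).
  apply: uniq_perm => //.
    rewrite cat_uniq us' filter_uniq // andbT /=.
    by apply/hasPn => v; rewrite mem_filter => /andP[].
  move=> v; rewrite mem_cat mem_filter.
  by have [/sub ->|] := boolP (v \in s').
rewrite expect_cat; apply: eq_expect => u'.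
by apply: (expect_id _ dep) => v; rewrite mem_filter => /andP[].
Qed.

Lemma expect_shift X Y s phi u :
  {in s, forall v, w (X + v.1, Y + v.2)%N = w v} ->
  expect w [seq (X + v.1, Y + v.2)%N | v <- s] (fun u => phi (shift X Y u)) u =
  expect w s phi (shift X Y u).
Proof.
elim: s u => //= v s IH u h; apply: eq_bigr => b _.
rewrite h ?mem_head // IH ?set_label_shift // => v' v's.
by rewrite h // inE v's orbT.
Qed.

End FiniteExpectation.

(** * The order of the vertices and the law of a configuration *)

(** The successor in the order in which the vertices are sampled: one step up the
antidiagonal, or back to the bottom row. *)
Definition next_vertex (v : nat * nat) : nat * nat :=
  if v.1 == 1 then (v.2.+1, 1) else (v.1.-1, v.2.+1).

Definition interior (v : nat * nat) : bool := (0 < v.1)%N && (0 < v.2)%N.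

(** The outputs that are determined when [v] is about to be sampled; boundary
vertices always count as known. *)
Definition known (v q : nat * nat) : bool :=
  interior q ==> s6v_before q.1 q.2 v.1 v.2.

Lemma interior_next v : interior v -> interior (next_vertex v).
Proof. by case: v => i j; rewrite /interior /next_vertex /=; case: eqP => /=; lia. Qed.

Lemma known_next v q : interior v -> known (next_vertex v) q = known v q || (q == v).
Proof.
case: v q => [i j] [i' j']; rewrite /interior /known /next_vertex /s6v_before /=.
rewrite /interior xpair_eqE /=; case: eqP => /=; lia.
Qed.

Lemma known_irrefl v : interior v -> ~~ known v v.
Proof. by case: v => i j iv; rewrite /known iv /s6v_before /= ltnn ltnn andbF. Qed.

Lemma interior_iter_next n : interior (iter n next_vertex (1, 1)%N).
Proof. by elim: n => //= n; apply: interior_next. Qed.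

Lemma known_iter_next n q :
  known (iter n next_vertex (1, 1)%N) q =
  ~~ interior q || (q \in traject next_vertex (1, 1)%N n).
Proof.
elim: n => [|n IH].
  case: q => i j; rewrite /known /interior /s6v_before /= in_nil; lia.
rewrite iterS known_next ?interior_iter_next // IH trajectSr mem_rcons inE.
by rewrite -orbA [_ || (_ == _)]orbC.
Qed.

Lemma uniq_traject_next n : uniq (traject next_vertex (1, 1)%N n).
Proof.
elim: n => // n IH; rewrite trajectSr rcons_uniq IH andbT.
have := known_irrefl (interior_iter_next n).
by rewrite known_iter_next negb_or => /andP[].
Qed.

(** The vertices known before (N + 1, 1) form the triangle i + j <= N + 1, so that
finitely many steps exhaust any bounded region. *)
Lemma next_vertex_reach N : exists n, iter n next_vertex (1, 1)%N = (N.+1, 1)%N.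
Proof.
elim: N => [|N [n hn]]; first by exists 0%N.
have diag k : (k <= N)%N ->
    exists m, iter m next_vertex (1, 1)%N = ((N - k).+1, k.+1).
  elim: k => [|k IH] kN; first by exists n; rewrite hn subn0.
  have [m hm] := IH (ltnW kN).
  exists m.+1; rewrite iterS hm /next_vertex /= ifF; first by congr (_, _); lia.
  by apply/eqP; lia.
have [m hm] := diag N (leqnn N).
by exists m.+1; rewrite iterS hm subnn.
Qed.

(** The vertices (i, j) with X < i <= X + x and Y < j <= Y + y, written as a
translate in order to match [expect_shift]. *)
Definition rect (X Y x y : nat) : seq (nat * nat) :=
  [seq (X + v.1, Y + v.2)%N | v <- [seq (i, j) | i <- iota 1 x, j <- iota 1 y]].

Lemma mem_rect X Y x y i j : ((i, j) \in rect X Y x y) =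
  (X < i <= X + x)%N && (Y < j <= Y + y)%N.
Proof.
apply/mapP/idP => [[[i' j'] /allpairsP[[a b] /= [ha hb [-> ->]]] /= [-> ->]]|h].
  by move: ha hb; rewrite !mem_iota; lia.
exists (i - X, j - Y)%N; last by congr (_, _) => /=; lia.
by apply/allpairsP; exists (i - X, j - Y)%N; split => //=; rewrite mem_iota; lia.
Qed.

Lemma uniq_rect X Y x y : uniq (rect X Y x y).
Proof.
rewrite map_inj_uniq; last by move=> [a b] [a' b'] /= [] /addnI -> /addnI ->.
by apply: allpairs_uniq; rewrite ?iota_uniq // => -[a b] [a' b'].
Qed.

Lemma rect_sub_traject x y : exists n,
  {subset rect 0 0 x y <= traject next_vertex (1, 1)%N n}.
Proof.
have [n hn] := next_vertex_reach (x + y); exists n => -[i j].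
rewrite mem_rect => ij.
have : known (iter n next_vertex (1, 1)%N) (i, j).
  by rewrite hn /known /s6v_before /=; lia.
rewrite known_iter_next => /orP[|//]; rewrite /interior /=; lia.
Qed.

Section Sampling.
Context (R : realType) (b1 b2 : nat -> nat -> R).

Definition bit_weight (v : nat * nat) (b : bool * bool) : R :=
  (if b.1 then b1 v.1 v.2 else 1 - b1 v.1 v.2) *
  (if b.2 then b2 v.1 v.2 else 1 - b2 v.1 v.2).

Lemma sum_pair_bool (F : bool * bool -> R) : \sum_b F b =
  F (true, true) + F (true, false) + (F (false, true) + F (false, false)).
Proof.
rewrite (eq_bigr (fun p => F (p.1, p.2))); last by case.
by rewrite -(pair_bigA _ (fun a b => F (a, b))) /= !big_bool.
Qed.

Lemma bit_weight1 v : \sum_b bit_weight v b = 1.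
Proof. by rewrite sum_pair_bool /bit_weight /=; ring. Qed.

(** Random bits reproduce the sampling rule of the model. *)
Lemma vertex_rule_law v bot lft (F : bool * bool -> R) :
  \sum_b bit_weight v b * F (vertex_rule b bot lft) =
  \sum_o s6v_weight (b1 v.1 v.2) (b2 v.1 v.2) bot lft o.1 o.2 * F o.
Proof.
rewrite !sum_pair_bool /bit_weight /vertex_rule /s6v_weight /=.
by case: bot lft => [] [] /=; ring.
Qed.

(** The mean of [phi] when the vertices of [s] are sampled one after the other,
starting from the partial configuration [c] and using the weights of the model
instead of bits. *)
Fixpoint sample_mean (s : seq (nat * nat)) (phi : (nat -> nat -> bool * bool) -> R)
    (c : nat -> nat -> bool * bool) : R :=
  if s is v :: s' then
    \sum_o s6v_weight (b1 v.1 v.2) (b2 v.1 v.2) (c v.1 v.2.-1).1 (c v.1.-1 v.2).2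
             o.1 o.2 * sample_mean s' phi (set_label c v o)
  else phi c.

Lemma step_config_set_label u v b i j : interior v -> known v (i, j) ->
  step_config (set_label u v b) i j = step_config u i j.
Proof.
case: v => vi vj iv; case: i j => [|i] [|j] // kv.
apply: (@step_config_local _ _ i.+1 j.+1) => // i' j' hi hj.
rewrite /set_label; case: eqP => // -[e1 e2].
by move: kv; rewrite /known /s6v_before /= => ?; lia.
Qed.

(** A vertex in the future of [v] does not influence the outputs known at [v], so
the configuration can be built from the bits while they are integrated. *)
Lemma sample_meanE n v phi c u : interior v ->
  depends_on (known (iter n next_vertex v)) phi ->
  (forall i j, known v (i, j) -> c i j = step_config u i j) ->
  sample_mean (traject next_vertex v n) phi c =
  expect bit_weight (traject next_vertex v n) (phi \o @step_config) u.
Proof.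
elim: n v c u => [|n IH] v c u iv dep cu; first exact: dep.
rewrite /= -vertex_rule_law; apply: eq_bigr => b _; congr (_ * _).
apply: IH; [exact: interior_next|by rewrite -iterSr|].
case: v iv dep cu => vi vj iv dep cu i j.
rewrite known_next // => /orP[kij|/eqP[-> ->]].
  rewrite step_config_set_label // -cu // /set_label; case: eqP => // e.
  by move: kij; rewrite e (negPf (known_irrefl iv)).
case: vi vj iv dep cu => [|vi] [|vj] // iv dep cu.
rewrite {1}/set_label eqxx /= !cu; last 2 first.
- by rewrite /known /s6v_before /interior /=; lia.
- by rewrite /known /s6v_before /interior /=; lia.
have E w : step_config w vi.+1 vj.+1 = vertex_rule (w vi.+1 vj.+1)
  (step_config w vi.+1 vj).1 (step_config w vi vj.+1).2 by [].
rewrite E {1}/set_label eqxx !step_config_set_label //.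
- by rewrite /known /s6v_before /interior /=; lia.
- by rewrite /known /s6v_before /interior /=; lia.
Qed.

End Sampling.

Section Law.
Context (R : realType) (d : measure_display) (T : measurableType d)
  (P : probability T R) (b1 b2 : nat -> nat -> R)
  (top right : nat -> nat -> {RV P >-> bool}).
Context (hS6V : stochastic_six_vertex b1 b2 top right).

(** The random configuration, with the boundary values of [step_config] put where
the model has no edge. *)
Definition sample (w : T) (i j : nat) : bool * bool :=
  if interior (i, j) then (top i j w, right i j w) else (false, true).

Definition sample_event (v : nat * nat) (c : nat -> nat -> bool * bool) : set T :=
  [set w | forall i j, known v (i, j) -> sample w i j = c i j].

Lemma measurable_sample i j o : measurable [set w | sample w i j = o].
Proof.
rewrite /sample; case: (interior _).
  have -> : [set w | (top i j w, right i j w) = o] =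
      (top i j @^-1` [set o.1]) `&` (right i j @^-1` [set o.2]).
    by case: o => a b; apply/seteqP; split => w /= [-> ->].
  by apply: measurableI; apply: measurable_funPTI.
have [->|ne] := eqVneq (false, true) o.
  by have -> : [set w : T | o = o] = setT by apply/seteqP.
have -> : [set w : T | (false, true) = o] = set0; last exact: measurable0.
by apply/seteqP; split => w //= e; rewrite e eqxx in ne.
Qed.

Lemma measurable_sample_event v c : measurable (sample_event v c).
Proof.
have -> : sample_event v c = \bigcap_i \bigcap_j
    (if known v (i, j) then [set w | sample w i j = c i j] else setT).
  apply/seteqP; split => w /= h i; first by move=> _ j _; case: ifP => // /h.
  by move=> j kij; have := h i I j I; rewrite kij.
apply: bigcapT_measurable => i; apply: bigcapT_measurable => j.
by case: ifP => _; [apply: measurable_sample|apply: measurableT].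
Qed.

Lemma sample_event_next v c o : interior v ->
  sample_event (next_vertex v) (set_label c v o) =
  sample_event v c `&` s6v_outputs top right v.1 v.2 o.1 o.2.
Proof.
move=> iv; apply/seteqP; split => w /=.
  move=> h; split=> [i j kij|].
    rewrite h ?known_next ?kij // /set_label; case: eqP => // e.
    by move: kij; rewrite e (negPf (known_irrefl iv)).
  have := h v.1 v.2; rewrite known_next // -surjective_pairing eqxx orbT.
  rewrite /sample /set_label -surjective_pairing eqxx iv => /(_ isT).
  by case: o {h} => a b [].
move=> [h [e1 e2]] i j; rewrite known_next // => kij.
rewrite /set_label; case: eqP kij => [e _|_]; last by rewrite orbF; apply: h.
rewrite /sample e iv; move: e1 e2; rewrite -e /= => -> ->.
by case: o {h}.
Qed.

Lemma sample_eventE v c : interior v ->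
  (forall i j, ~~ interior (i, j) -> c i j = (false, true)) ->
  sample_event v c =
    s6v_history top right (fun i j => (c i j).1) (fun i j => (c i j).2) v.1 v.2
    `&` s6v_inputs top right v.1 v.2 (c v.1 v.2.-1).1 (c v.1.-1 v.2).2.
Proof.
case: hS6V => hr ht _; case: v => [[|vi] [|vj]] // iv cb.
have sample_top w i j : (0 < i)%N -> (sample w i j).1 = top i j w.
  by case: i j => [|i] [|j] //; rewrite /sample /= ht.
have sample_right w i j : (0 < j)%N -> (sample w i j).2 = right i j w.
  by case: i j => [|i] [|j] //; rewrite /sample /= hr.
apply/seteqP; split => w /=.
  move=> h; split.
    move=> i j i0 j0 bij; rewrite -(sample_top w) // -(sample_right w) //.
    by rewrite h // /known bij implybT.
  rewrite /s6v_inputs /= -(sample_top w) // -(sample_right w) //.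
  by rewrite !h // /known /interior /s6v_before /=; lia.
move=> [h _] i j; rewrite /known; have [iij /= bij|nij _] := boolP (interior (i, j)).
  move: (iij); rewrite /interior /= => /andP[i0 j0].
  rewrite /sample iij; have [-> ->] := h _ _ i0 j0 bij.
  by case: (c i j).
by rewrite /sample (negPf nij) cb.
Qed.

Lemma sample_event_step v c o : interior v ->
  (forall i j, ~~ interior (i, j) -> c i j = (false, true)) ->
  P (sample_event (next_vertex v) (set_label c v o)) =
  (P (sample_event v c) * (s6v_weight (b1 v.1 v.2) (b2 v.1 v.2)
      (c v.1 v.2.-1).1 (c v.1.-1 v.2).2 o.1 o.2)%:E)%E.
Proof.
move=> iv cb; rewrite sample_event_next // sample_eventE //.
case: hS6V => _ _; case/andP: iv => v1 v2; exact.
Qed.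

(** Induction on the number of vertices still to be sampled: given the past, the
event splits according to the outputs of the next vertex, and the sampling rule
gives the probability of each piece. *)
Lemma integral_sample_event n v c (phi : (nat -> nat -> bool * bool) -> R) :
  interior v -> (forall i j, ~~ interior (i, j) -> c i j = (false, true)) ->
  (forall c, 0 <= phi c) -> depends_on (known (iter n next_vertex v)) phi ->
  measurable_fun setT (EFin \o (fun w => phi (sample w))) ->
  (\int[P]_(w in sample_event v c) (phi (sample w))%:E =
   P (sample_event v c) * (sample_mean b1 b2 (traject next_vertex v n) phi c)%:E)%E.
Proof.
move=> + + phi0; elim: n v c => [|n IH] v c iv cb dep mphi.
  rewrite (eq_integral (cst (phi c)%:E)).
    by rewrite (integral_cst P (measurable_sample_event v c)) muleC.
  move=> w; rewrite inE => h; congr EFin; apply: dep => i j; exact: h.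
have split_event : sample_event v c = \big[setU/set0]_(o <- enum {: bool * bool})
    sample_event (next_vertex v) (set_label c v o).
  rewrite -bigcup_seq; apply/seteqP; split => w /=.
    move=> h; exists (top v.1 v.2 w, right v.1 v.2 w) => /=.
      by rewrite mem_enum.
    by rewrite sample_event_next //; split.
  by move=> [q _]; rewrite sample_event_next // => -[].
rewrite [in LHS]split_event ge0_integral_bigsetU //=; first last.
- by move=> w _; rewrite lee_fin.
- exact: measurable_funTS.
- move=> o o' _ _ [w []]; rewrite !sample_event_next // /s6v_outputs /=.
  by case: o o' => [x y] [x' y'] /= [_ [-> ->]] [_ [-> ->]].
- exact: enum_uniq.
- by move=> o; apply: measurable_sample_event.
have /fineK <- : P (sample_event v c) \is a fin_num.
  exact/fin_num_measure/measurable_sample_event.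
rewrite big_enum /= -EFinM mulr_sumr -sumEFin; apply: eq_big => [q|q _].
  by [].
rewrite IH //; last 3 first.
- exact: interior_next.
- move=> i j nij; rewrite /set_label; case: eqP => [e|_]; last exact: cb.
  by rewrite e iv in nij.
- by rewrite -iterSr.
have := fin_num_measure P _ (measurable_sample_event v c).
by rewrite sample_event_step // => /fineK <-; rewrite -!EFinM mulrA.
Qed.

Lemma integral_sample n (phi : (nat -> nat -> bool * bool) -> R) u :
  (forall c, 0 <= phi c) ->
  depends_on (known (iter n next_vertex (1, 1)%N)) phi ->
  measurable_fun setT (EFin \o (fun w => phi (sample w))) ->
  (\int[P]_w (phi (sample w))%:E =
   (expect (bit_weight b1 b2) (traject next_vertex (1, 1)%N n)
     (phi \o @step_config) u)%:E)%E.
Proof.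
move=> phi0 dep mphi.
have boundary v i j : ~~ interior (i, j) -> step_config v i j = (false, true).
  by case: i j => [|i] [|j].
have sT : sample_event (1, 1)%N (step_config u) = setT.
  apply/seteqP; split => // w _ i j.
  rewrite (known_iter_next 0) in_nil orbF => nij.
  by rewrite /sample (negPf nij) boundary.
have := @integral_sample_event n (1, 1)%N (step_config u) phi isT (boundary u).
rewrite sT probability_setT mul1e => -> //.
congr EFin; exact: sample_meanE.
Qed.

(** The expectation of a function of the edges in a box is a finite sum over the
bits of that box. Every use of the law of the model goes through this lemma. *)
Lemma integral_sample_box x y (phi : (nat -> nat -> bool * bool) -> R) u :
  (forall c, 0 <= phi c) ->
  depends_on (fun q => (q.1 <= x)%N && (q.2 <= y)%N) phi ->
  measurable_fun setT (EFin \o (fun w => phi (sample w))) ->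
  (\int[P]_w (phi (sample w))%:E =
   (expect (bit_weight b1 b2) (rect 0 0 x y) (phi \o @step_config) u)%:E)%E.
Proof.
move=> phi0 dep mphi; have [n sub] := rect_sub_traject x y.
have box i j : (i <= x)%N && (j <= y)%N -> ~~ interior (i, j) || ((i, j) \in rect 0 0 x y).
  by rewrite mem_rect /interior /=; lia.
rewrite (integral_sample (n := n) u) //; last first.
  move=> c c' h; apply: dep => i j /box ij; apply: h.
  by rewrite known_iter_next; case/orP: ij => [->|/sub ->]; rewrite ?orbT.
congr EFin; apply: expect_sub => //; last 2 first.
- exact: uniq_traject_next.
- exact: uniq_rect.
- exact: bit_weight1.
move=> u1 u2 h; apply: dep => i j /andP[/= ix jy].
apply: (step_config_local (x := x) (y := y)) => // i' j' hi hj.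
by apply: h; rewrite /= mem_rect !add0n hi hj.
Qed.

Lemma sample_height w x y : height (sample w) x y = s6v_height right w x y.
Proof.
case: x => [|x]; rewrite /height /s6v_height.
  by rewrite sum1_card card_ord.
by rewrite big_add1 big_mkord.
Qed.

End Law.

(** * Moments of the height function *)

Section Mean.
Context (R : realType) (b1 b2 : nat -> nat -> R).
Local Notation w := (bit_weight b1 b2).

(** The mean of [F (h (x, y))]. The labels outside of the rectangle do not matter;
a constant labelling is chosen because it is invariant under shifts. *)
Definition height_mean (F : nat -> R) (x y : nat) : R :=
  expect w (rect 0 0 x y) (fun u => F (height (step_config u) x y))
    (fun _ _ => (true, true)).

Lemma depends_on_step_height F X Y x y :
  depends_on (mem (rect X Y x y))
    (fun u => F (height (step_config (shift X Y u)) x y) : R).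
Proof.
move=> u u' h; congr F; apply: step_height_local => i j hi hj.
by apply: h; rewrite /= mem_rect; lia.
Qed.

Lemma height_mean_sub F s x y : uniq s -> {subset rect 0 0 x y <= s} ->
  expect w s (fun u => F (height (step_config u) x y)) (fun _ _ => (true, true)) =
  height_mean F x y.
Proof.
move=> us sub; apply: expect_sub => //; last exact: uniq_rect.
- exact: bit_weight1.
- exact: (@depends_on_step_height F 0 0).
Qed.

Lemma rect_shift X Y x y :
  rect X Y x y = [seq (X + v.1, Y + v.2)%N | v <- rect 0 0 x y].
Proof. by rewrite /rect -map_comp. Qed.

Lemma height_mean_shift F s X Y x y : uniq s -> {subset rect X Y x y <= s} ->
  (forall v, interior v -> w (X + v.1, Y + v.2)%N = w v) ->
  expect w s (fun u => F (height (step_config (shift X Y u)) x y))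
    (fun _ _ => (true, true)) = height_mean F x y.
Proof.
move=> us sub per.
rewrite (@expect_sub _ _ _ _ _ (rect X Y x y)) //; last 3 first.
- exact: bit_weight1.
- exact: depends_on_step_height.
- exact: uniq_rect.
rewrite rect_shift.
rewrite (expect_shift (fun u => F (height (step_config u) x y))) // => -[i j].
by rewrite mem_rect => ij; apply: per; rewrite /interior /=; lia.
Qed.

Context (hb : forall i j : nat, (0 < i)%N -> (0 < j)%N ->
            0 <= b1 i j <= 1 /\ 0 <= b2 i j <= 1).

Lemma bit_weight_ge0 X Y x y v b : v \in rect X Y x y -> 0 <= w v b.
Proof.
case: v => i j; rewrite mem_rect => ij.
have [|//|h1 h2] := @hb i j; [lia|lia|].
by rewrite /bit_weight; apply: mulr_ge0 => /=; case: ifP => _; lra.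
Qed.

Local Notation mean := (height_mean (fun k => k%:R)).
Local Notation mean2 := (height_mean (fun k => k%:R ^+ 2)).

Lemma sub_rect x y x' y' : (x <= x')%N -> (y <= y')%N ->
  {subset rect 0 0 x y <= rect 0 0 x' y'}.
Proof. by move=> hx hy [i j]; rewrite !mem_rect; lia. Qed.

Lemma height_mean_ge0 (F : nat -> R) x y : (forall k, 0 <= F k) ->
  0 <= height_mean F x y.
Proof.
move=> F0; rewrite -[X in X <= _](@expect_cst _ _ w _ (rect 0 0 x y) 0 (fun _ _ => (true, true))).
  by apply: le_expect => // v b; apply: bit_weight_ge0.
exact: bit_weight1.
Qed.

Lemma height_mean_lipx x y : mean x.+1 y <= mean x y <= mean x.+1 y + 1.
Proof.
rewrite -(@height_mean_sub _ (rect 0 0 x.+1 y) x y) ?uniq_rect //; last first.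
  by apply: sub_rect.
apply/andP; split.
  apply: le_expect => [v b|u]; first exact: bit_weight_ge0.
  by rewrite ler_nat; have /andP[] := step_height_lipx u x y.
rewrite -[X in _ + X](expect_cst (bit_weight1 b1 b2) (rect 0 0 x.+1 y) 1 (fun _ _ => (true, true))).
rewrite /height_mean -expectD; apply: le_expect => [v b|u]; first exact: bit_weight_ge0.
by rewrite natr1 ler_nat; have /andP[] := step_height_lipx u x y.
Qed.

Lemma height_mean_lipy x y : mean x y <= mean x y.+1 <= mean x y + 1.
Proof.
rewrite -(@height_mean_sub _ (rect 0 0 x y.+1) x y) ?uniq_rect //; last first.
  by apply: sub_rect.
apply/andP; split.
  apply: le_expect => [v b|u]; first exact: bit_weight_ge0.
  by rewrite ler_nat; have /andP[] := height_lipy (step_config u) x y.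
rewrite -[X in _ + X](expect_cst (bit_weight1 b1 b2) (rect 0 0 x y.+1) 1 (fun _ _ => (true, true))).
rewrite /height_mean -expectD; apply: le_expect => [v b|u]; first exact: bit_weight_ge0.
by rewrite natr1 ler_nat; have /andP[] := height_lipy (step_config u) x y.
Qed.

Lemma height_variance x y :
  height_mean (fun k => (k%:R - mean x y) ^+ 2) x y = mean2 x y - mean x y ^+ 2.
Proof.
set m := mean x y.
have -> : mean2 x y - m ^+ 2 = mean2 x y + ((- m) *+ 2 * mean x y + m ^+ 2).
  by rewrite -/m; ring.
rewrite /height_mean -expectZ.
rewrite -(expect_cst (bit_weight1 b1 b2) (rect 0 0 x y) (m ^+ 2) (fun _ _ => (true, true))).
rewrite -!expectD; apply: eq_expect => u; ring.
Qed.

Section Shift.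
Context (X Y x y : nat).
Context (per : forall v, interior v -> w (X + v.1, Y + v.2)%N = w v).

Let sub1 : {subset rect 0 0 X Y <= rect 0 0 (X + x) (Y + y)}.
Proof. by apply: sub_rect; apply: leq_addr. Qed.

Let sub2 : {subset rect X Y x y <= rect 0 0 (X + x) (Y + y)}.
Proof. by move=> [i j]; rewrite !mem_rect; lia. Qed.

Lemma height_mean_subadd : mean (X + x) (Y + y) <= mean X Y + mean x y.
Proof.
rewrite -(height_mean_sub _ (uniq_rect _ _ _ _) sub1).
rewrite -(height_mean_shift _ (uniq_rect _ _ _ _) sub2 per) -expectD.
apply: le_expect => [v b|u]; first exact: bit_weight_ge0.
by rewrite -natrD ler_nat; apply: height_subadd.
Qed.

(** The square of [height_subadd] is taken before averaging; independence of the
two rectangles gives the cross term. *)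
Lemma height_mean2_subadd : mean2 (X + x) (Y + y) <=
  mean2 X Y + mean X Y * mean x y *+ 2 + mean2 x y.
Proof.
rewrite -!(height_mean_sub _ (uniq_rect _ _ _ _) sub1).
rewrite -!(height_mean_shift _ (uniq_rect _ _ _ _) sub2 per).
rewrite -(@expect_indep _ _ _ (bit_weight1 b1 b2) _ (mem (rect 0 0 X Y))); last 2 first.
- exact: (@depends_on_step_height _ 0 0).
- move=> u u' h; apply: (@depends_on_step_height _ X Y x y) => i j ij.
  by apply: h; move: ij; rewrite /= !mem_rect; lia.
rewrite -mulr_natl -expectZ -!expectD.
apply: le_expect => [v b|u]; first exact: bit_weight_ge0.
rewrite [leRHS](_ : _ = ((height (step_config u) X Y +
   height (step_config (shift X Y u)) x y)%N%:R) ^+ 2); last by rewrite natrD; ring.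
by rewrite -!natrX ler_nat leq_exp2r // height_subadd.
Qed.

End Shift.
End Mean.

(** * Fekete's lemma and Lipschitz functions on the lattice *)

Section Analysis.
Context (R : realType).

Lemma cvg_inv_nat (C : R) : C / n%:R @[n --> \oo] --> (0 : R).
Proof.
rewrite -(mulr0 C); apply: cvgMr; apply/cvgrPdist_lt => /= e e0.
exists (Num.truncn e^-1).+1 => // n /= hn.
rewrite sub0r normrN normfV ger0_norm ?ler0n // invf_plt ?posrE //; last first.
  by rewrite ltr0n; apply: leq_trans hn.
apply: lt_le_trans (_ : (Num.truncn e^-1).+1%:R <= _); first exact: truncnS_gt.
by rewrite ler_nat.
Qed.

(** Fekete's lemma: f n / n tends to its infimum. Compare f n with f at a multiple
of a nearly optimal m, the remainder of the division by m contributing a bounded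
amount. *)
Lemma fekete (f : nat -> R) : (forall n, 0 <= f n) ->
  (forall n m, f (n + m)%N <= f n + f m) -> cvgn (fun n => f n / n%:R).
Proof.
move=> f0 sub.
pose E := [set f n.+1 / n.+1%:R | n in setT].
have Einf : has_inf E.
  split; first by exists (f 1 / 1%:R); exists 0%N.
  by exists 0 => _ [n _ <-]; apply: divr_ge0.
apply/cvg_ex; exists (inf E); apply/cvgrPdist_lt => /= e e0.
have e20 : 0 < e / 2 by lra.
have [_ [m _ <-] hm] := inf_adherent e20 Einf.
pose C := \sum_(i < m.+1) f i.
have fq q r : f (q * m.+1 + r)%N <= q%:R * f m.+1 + f r.
  elim: q => [|q IH]; first by rewrite mul0r add0r.
  rewrite mulSn -addnA (le_trans (sub _ _)) // -natr1 mulrDl mul1r; lra.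
have fC r : (r < m.+1)%N -> f r <= C.
  by move=> rm; rewrite /C (bigD1 (Ordinal rm)) //= lerDl sumr_ge0.
have /cvgrPdist_lt /(_ _ e20) := cvg_inv_nat C.
apply: filterS2 (nbhs_infty_gt 0) => n n0.
have nR : 0 < n%:R :> R by rewrite ltr0n.
rewrite sub0r normrN ger0_norm; last by apply: divr_ge0; rewrite ?sumr_ge0.
move=> hC.
have h1 : inf E <= f n / n%:R.
  by apply: ge_inf Einf.2 _ _; case: n n0 {nR hC} => // n _; exists n.
have h2 : f n / n%:R <= f m.+1 / m.+1%:R + C / n%:R.
  rewrite {1}(divn_eq n m.+1).
  apply: (@le_trans _ _ (((n %/ m.+1)%:R * f m.+1 + C) / n%:R)).
    rewrite ler_pM2r ?invr_gt0 // (le_trans (fq _ _)) // lerD2l fC //.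
    by rewrite ltn_mod.
  rewrite mulrDl lerD2r ler_pdivrMr // mulrAC ler_pdivlMr ?ltr0n //.
  rewrite mulrAC [leRHS]mulrC ler_wpM2r // -natrM ler_nat.
  exact: leq_trunc_div.
rewrite ltr_distlC; apply/andP; split.
  by rewrite ltrBlDr (le_lt_trans h1) // ltrDl.
apply: le_lt_trans h2 (lt_le_trans (ltrD hm hC) _); lra.
Qed.

(** The sum of V_k / 2 over k < n, increased by V_n + A_n, does not grow with n. *)
Lemma sum_of_halving_le (V A : nat -> R) : (forall k, 0 <= V k) ->
  (forall k, 0 <= A k) -> (forall k, V k.+1 + A k.+1 <= V k / 2 + A k) ->
  forall n, \sum_(k < n) V k <= 2 * (V 0%N + A 0%N).
Proof.
move=> V0 A0 h n.
suff : (\sum_(k < n) V k) / 2 + (V n + A n) <= V 0%N + A 0%N.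
  have := V0 n; have := A0 n; lra.
elim: n => [|n IH]; first by rewrite big_ord0 mul0r add0r.
rewrite big_ord_recr /=; have := h n; lra.
Qed.

Section LatticeLipschitz.
Context (L : R) (D : nat -> nat -> R).
Context (hD : forall x y, `|D x.+1 y - D x y| <= L /\ `|D x y.+1 - D x y| <= L).

Lemma lattice_lipD x y a b : `|D (x + a) (y + b) - D x y| <= L * (a + b)%N%:R.
Proof.
elim: a => [|a IH].
  rewrite addn0 add0n; elim: b => [|b IH]; first by rewrite addn0 subrr normr0 mulr0.
  rewrite addnS -natr1 mulrDr mulr1.
  apply: le_trans (ler_distD (D x (y + b)) _ _) _; rewrite addrC; apply: lerD => //.
  exact: (hD _ _).2.
rewrite addnS addSn -natr1 mulrDr mulr1.
apply: le_trans (ler_distD (D (x + a) (y + b)) _ _) _; rewrite addrC; apply: lerD => //.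
exact: (hD _ _).1.
Qed.

Lemma lattice_lip x y x' y' :
  `|D x y - D x' y'| <= L * (`|x%:R - x'%:R| + `|y%:R - y'%:R|).
Proof.
have dist a b : `|a%:R - (a + b)%N%:R| = b%:R :> R.
  by rewrite natrD opprD addrA subrr sub0r normrN normr_nat.
have moveX a b z : `|D a z - D (a + b) z| <= L * b%:R.
  by have := lattice_lipD a z b 0; rewrite !addn0 distrC.
have moveY a b z : `|D z a - D z (a + b)| <= L * b%:R.
  by have := lattice_lipD z a 0 b; rewrite addn0 add0n distrC.
rewrite mulrDr; apply: le_trans (ler_distD (D x' y) _ _) _; apply: lerD.
  have [/subnKC <-|/ltnW /subnKC <-] := leqP x x'; first by rewrite dist.
  by rewrite distrC [X in L * X]distrC dist.
have [/subnKC <-|/ltnW /subnKC <-] := leqP y y'; first by rewrite dist.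
by rewrite distrC [X in L * X]distrC dist.
Qed.

(** For n of order 2 ^ (k + m), the point (x n, y n) is within 2 ^ k I and 2 ^ k J
of the grid of mesh 2 ^ k (I, J). The error, divided by n, is at most
L (I + J) / 2 ^ m, and only the grid points (p, q) with p, q < N are met, where N
does not depend on k. So first m is chosen large, then n. *)
Lemma dyadic_interpolation (I J c : nat) (x y : nat -> nat) :
  (0 < I)%N -> (0 < J)%N ->
  (forall p q, D (2 ^ k * (p * I)) (2 ^ k * (q * J)) / 2 ^+ k @[k --> \oo] --> (0 : R)) ->
  (forall n, (x n <= c * n)%N) -> (forall n, (y n <= c * n)%N) ->
  D (x n) (y n) / n%:R @[n --> \oo] --> (0 : R).
Proof.
move=> I0 J0 hdy xc yc; apply/cvgrPdist_lt => /= e e0.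
have e20 : 0 < e / 2 by lra.
have L0 : 0 <= L by apply: le_trans (hD 0%N 0%N).1.
have [m hm] : exists m, L * (I + J)%N%:R < e / 2 * 2 ^+ m.
  exists (Num.truncn ((e / 2)^-1 * (L * (I + J)%N%:R))).+1.
  rewrite -ltr_pdivrMl //; apply: lt_le_trans (truncnS_gt _) _.
  by rewrite -natrX ler_nat ltnW // ltn_expl.
pose N := (c * 2 ^ m.+1).+1.
pose s k := \sum_(p < N) \sum_(q < N) `|D (2 ^ k * (p * I)) (2 ^ k * (q * J)) / 2 ^+ k|.
have s0 : s k @[k --> \oo] --> (0 : R).
  rewrite (_ : 0 = \sum_(p < N) \sum_(q < N) (0 : R)); last first.
    by rewrite big1 // => p _; rewrite big1.
  apply: cvg_big => [|p _]; first exact: add_continuous.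
  apply: cvg_big => [|q _]; first exact: add_continuous.
  by rewrite -(normr0 R); apply: cvg_norm.
have /cvgrPdist_lt /(_ _ e20) [k0 _ hk0] := s0.
exists (2 ^ (k0 + m))%N => // n /= hn.
have n0 : (0 < n)%N by apply: leq_trans hn; rewrite expn_gt0.
have /andP[n_ge n_lt] := trunc_log_bounds (leqnn 2) n0.
have log_ge : (k0 + m <= trunc_log 2 n)%N by rewrite trunc_log_max.
pose k := (trunc_log 2 n - m)%N.
have hk : (k0 <= k)%N by rewrite /k; lia.
have kn : (2 ^ (k + m) <= n)%N by rewrite /k subnK //; lia.
have nk : (n < 2 ^ (k + m).+1)%N by rewrite /k subnK //; lia.
have small z K : (0 < K)%N -> (z <= c * n)%N -> (z %/ (2 ^ k * K) < N)%N.
  move=> K0 zc; apply: leq_ltn_trans (_ : (z %/ 2 ^ k < N)%N).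
    by rewrite leq_div2l ?expn_gt0 // leq_pmulr.
  rewrite ltn_divLR ?expn_gt0 //; apply: leq_ltn_trans zc _.
  rewrite /N mulSn -mulnA -expnD.
  have cn : (c * n <= c * 2 ^ (m.+1 + k))%N.
    by rewrite leq_mul2l addSn (addnC m) ltnW ?orbT.
  by apply: leq_ltn_trans cn _; rewrite -[ltnLHS]add0n ltn_add2r expn_gt0.
pose p := (x n %/ (2 ^ k * I))%N; pose q := (y n %/ (2 ^ k * J))%N.
have hp : (p < N)%N by apply: small.
have hq : (q < N)%N by apply: small.
pose D0 := D (2 ^ k * (p * I)) (2 ^ k * (q * J)).
(* (p, q) indexes the grid point below (x n, y n). *)
have near_D0 : `|D (x n) (y n) - D0| <= L * (2 ^+ k * (I + J)%N%:R).
  rewrite (divn_eq (x n) (2 ^ k * I)) (divn_eq (y n) (2 ^ k * J)) -/p -/q.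
  rewrite !(mulnCA _ (2 ^ k)%N).
  apply: le_trans (lattice_lipD _ _ _ _) _.
  rewrite ler_wpM2l // -natrX -natrM ler_nat mulnDr.
  by apply: leq_add; apply/ltnW; rewrite ltn_mod muln_gt0 expn_gt0 ?I0 ?J0.
have D0s : `|D0| <= s k * 2 ^+ k.
  have k2 : 0 < 2 ^+ k :> R by rewrite exprn_gt0.
  rewrite -ler_pdivrMr // -[X in _ / X]gtr0_norm // -normf_div.
  rewrite /s (bigD1 (Ordinal hp)) //= (bigD1 (Ordinal hq)) //= -addrA lerDl.
  by rewrite addr_ge0 // sumr_ge0 // => ? _; rewrite ?sumr_ge0.
have sk : s k < e / 2.
  have := hk0 k hk; rewrite sub0r normrN ger0_norm // sumr_ge0 // => ? _.
  by rewrite sumr_ge0.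
have nR : 0 < n%:R :> R by rewrite ltr0n.
rewrite sub0r normrN normf_div (gtr0_norm nR) ltr_pdivrMr //.
have knR : 2 ^+ k * 2 ^+ m <= n%:R :> R by rewrite -exprD -natrX ler_nat.
have k2 : 0 < 2 ^+ k :> R by rewrite exprn_gt0.
have m1 : 1 <= 2 ^+ m :> R by rewrite exprn_ege1 // ler1n.
have t1 : `|D (x n) (y n)| <= L * (2 ^+ k * (I + J)%N%:R) + s k * 2 ^+ k.
  rewrite -(subrK D0 (D (x n) (y n))); apply: le_trans (ler_normD _ _) _.
  exact: lerD.
apply: le_lt_trans t1 _.
have t2 : L * (2 ^+ k * (I + J)%N%:R) < e / 2 * n%:R.
  rewrite mulrCA; apply: (@lt_le_trans _ _ (2 ^+ k * (e / 2 * 2 ^+ m))).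
    by rewrite ltr_pM2l.
  by rewrite mulrCA ler_pM2l.
have t3 : s k * 2 ^+ k <= e / 2 * n%:R.
  apply: ler_pM; [|exact: ltW|exact: ltW|].
    by rewrite sumr_ge0 // => ? _; rewrite sumr_ge0.
  apply: le_trans knR; rewrite ler_peMr // ltW //.
apply: lt_le_trans (ltr_leD t2 t3) _.
by rewrite -mulrDl (_ : e / 2 + e / 2 = e) //; lra.
Qed.
End LatticeLipschitz.

Lemma truncn_mulrn (x : R) n : 0 <= x ->
  (Num.truncn (n%:R * x) <= (Num.truncn x).+1 * n)%N.
Proof.
move=> x0; have nx0 : 0 <= n%:R * x by rewrite mulr_ge0.
rewrite -(ler_nat R); apply: (@le_trans _ _ (n%:R * x)); first by rewrite truncn_le.
rewrite natrM mulrC.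
by rewrite ler_wpM2r // ltW // truncnS_gt.
Qed.

Lemma truncn_addn (x : R) n m : 0 <= x -> exists e, (e <= 1)%N /\
  Num.truncn ((n + m)%N%:R * x) =
  (Num.truncn (n%:R * x) + Num.truncn (m%:R * x) + e)%N.
Proof.
move=> x0; rewrite natrD mulrDl.
have nx0 k : 0 <= k%:R * x by rewrite mulr_ge0.
have lo k : (Num.truncn (k%:R * x))%:R <= k%:R * x by rewrite truncn_le.
have hi k := truncnS_gt (k%:R * x).
set a := Num.truncn (n%:R * x); set b := Num.truncn (m%:R * x).
set s := n%:R * x + m%:R * x.
have s0 : 0 <= s by rewrite addr_ge0.
have h1 : (a + b <= Num.truncn s)%N.
  by rewrite truncn_ge_nat // natrD; apply: lerD; apply: lo.
have h2 : (Num.truncn s < a + b + 2)%N.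
  rewrite truncn_lt_nat //; apply: lt_le_trans (ltrD (hi n) (hi m)) _.
  by rewrite -natrD ler_nat -/a -/b; lia.
by exists (Num.truncn s - (a + b))%N; lia.
Qed.

Lemma dist_truncn_mulrn (x x' : R) n : 0 <= x -> 0 <= x' ->
  `|(Num.truncn (n%:R * x))%:R - (Num.truncn (n%:R * x'))%:R| <=
  n%:R * `|x - x'| + 1.
Proof.
move=> x0 x'0.
have nx0 (z : R) : 0 <= z -> 0 <= n%:R * z by move=> z0; rewrite mulr_ge0.
have l : (Num.truncn (n%:R * x))%:R <= n%:R * x by rewrite truncn_le nx0.
have h := truncnS_gt (n%:R * x).
have l' : (Num.truncn (n%:R * x'))%:R <= n%:R * x' by rewrite truncn_le nx0.
have h' := truncnS_gt (n%:R * x').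
rewrite -natr1 in h; rewrite -natr1 in h'.
rewrite -[X in X * `|_|]normr_nat -normrM mulrBr.
move: (n%:R * x) (n%:R * x') l h l' h' => z z' l h l' h'.
rewrite ler_norml; have := ler_norm (z - z'); have := ler_norm (z' - z).
by rewrite [in X in X -> _]distrC; lra.
Qed.

Section ScalingLimit.
Context (I J : nat) (a : nat -> nat -> R).
Context (I0 : (0 < I)%N) (J0 : (0 < J)%N) (a0 : forall x y, 0 <= a x y)
  (a_lip : forall x y, `|a x.+1 y - a x y| <= 1 /\ `|a x y.+1 - a x y| <= 1)
  (a_sub : forall p q x y,
     a (p * I + x)%N (q * J + y)%N <= a (p * I)%N (q * J)%N + a x y).

Let ray (x y : R) n := a (Num.truncn (n%:R * x)) (Num.truncn (n%:R * y)).

(** Subadditivity is assumed only for a first point on the period lattice; other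
points are rounded down to it. *)
Lemma almost_subadd x y x' y' :
  a (x + x')%N (y + y')%N <= a x y + a x' y' + 2 * (I + J)%N%:R.
Proof.
have xI := ltnW (ltn_pmod x I0); have yJ := ltnW (ltn_pmod y J0).
have near z z' : `|a (x %/ I * I + z + x %% I)%N (y %/ J * J + z' + y %% J)%N -
    a (x %/ I * I + z)%N (y %/ J * J + z')%N| <= (I + J)%N%:R.
  rewrite (le_trans (lattice_lipD a_lip _ _ _ _)) // mul1r ler_nat.
  exact: leq_add.
have := near 0%N 0%N; rewrite !addn0 -!divn_eq.
have := near x' y'; rewrite !(addnAC _ _ (_ %% _)%N) -!divn_eq.
have := a_sub (x %/ I) (y %/ J) x' y'.
rewrite !ler_norml => h /andP[h1 h2] /andP[h3 h4]; lra.
Qed.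

(** Adding a constant to the sequence absorbs the bounded errors, those of
[almost_subadd] and those of the integer parts, and makes it subadditive. *)
Lemma ray_cvg x y : 0 <= x -> 0 <= y -> cvgn (fun n => ray x y n / n%:R).
Proof.
move=> x0 y0; pose C : R := 2 * (I + J)%N%:R + 2.
have C0 : 0 <= C by rewrite addr_ge0 ?mulr_ge0.
have /cvg_ex[l hl] : cvgn (fun n => (ray x y n + C) / n%:R).
  apply: fekete => [n|n m]; first by apply: addr_ge0 => //; apply: a0.
  have [e [e1 ex]] := truncn_addn n m x0; have [e' [e'1 ey]] := truncn_addn n m y0.
  have := lattice_lipD a_lip (Num.truncn (n%:R * x) + Num.truncn (m%:R * x))
    (Num.truncn (n%:R * y) + Num.truncn (m%:R * y)) e e'.
  rewrite -ex -ey -/(ray x y _) mul1r ler_norml => /andP[_].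
  have := almost_subadd (Num.truncn (n%:R * x)) (Num.truncn (n%:R * y))
    (Num.truncn (m%:R * x)) (Num.truncn (m%:R * y)).
  rewrite -/(ray x y n) -/(ray x y m).
  have : (e + e')%N%:R <= 2 :> R by rewrite ler_nat; lia.
  rewrite /C; lra.
apply/cvg_ex; exists (l - 0).
rewrite (_ : (fun n => _) = (fun n => (ray x y n + C) / n%:R - C / n%:R)).
  exact: cvgB hl (cvg_inv_nat C).
by apply/funext => n; rewrite -mulrBl addrK.
Qed.

Definition scaling_limit (p : R * R) : R :=
  limn (fun n => ray p.1 p.2 n / n%:R).

Lemma scaling_limit_cvg x y : 0 <= x -> 0 <= y ->
  ray x y n / n%:R @[n --> \oo] --> scaling_limit (x, y).
Proof. by move=> x0 y0; apply: ray_cvg. Qed.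

Lemma scaling_limit_dist x y x' y' : 0 <= x -> 0 <= y -> 0 <= x' -> 0 <= y' ->
  `|scaling_limit (x, y) - scaling_limit (x', y')| <= `|x - x'| + `|y - y'|.
Proof.
move=> x0 y0 x'0 y'0; set dl := (X in _ <= X).
have hl : `|ray x y n / n%:R - ray x' y' n / n%:R| @[n --> \oo] -->
    `|scaling_limit (x, y) - scaling_limit (x', y')|.
  by apply: cvg_norm; apply: cvgB; apply: scaling_limit_cvg.
have hr : dl + 2 / n%:R @[n --> \oo] --> dl + 0.
  by apply: cvgD; [exact: cvg_cst|exact: cvg_inv_nat].
rewrite -[dl]addr0; apply: (ler_cvg_to hl hr).
apply: filterS (nbhs_infty_gt 0) => n n0.
have nR : 0 < n%:R :> R by rewrite ltr0n.
rewrite -mulrBl normrM normfV (gtr0_norm nR) ler_pdivrMr // mulrDl mulfVK ?gt_eqF //.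
apply: le_trans (lattice_lip a_lip _ _ _ _) _; rewrite mul1r.
have := dist_truncn_mulrn n x0 x'0; have := dist_truncn_mulrn n y0 y'0.
rewrite /dl; lra.
Qed.

Lemma scaling_limit_lipschitz :
  [lipschitz scaling_limit p | p in [set p : R * R | 0 <= p.1 /\ 0 <= p.2]].
Proof.
apply: (@klipschitzW _ _ _ 2).
  by apply: (@globally_properfilter _ _ ((0, 0), (0, 0))).
case=> -[x y] [x' y'] /= [[x0 y0] [x'0 y'0]].
apply: le_trans (scaling_limit_dist x0 y0 x'0 y'0) _.
rewrite prod_normE /= mulr_natl mulr2n.
by apply: lerD; rewrite le_max lexx ?orbT.
Qed.

End ScalingLimit.
End Analysis.

(** * Almost sure convergence along dyadic rays *)

Lemma cvg0_of_summable_square (R : realType) (y : nat -> R) (C : R) :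
  (forall n, \sum_(k < n) y k ^+ 2 <= C) -> y k @[k --> \oo] --> (0 : R).
Proof.
move=> yC.
have y2 : y k ^+ 2 @[k --> \oo] --> (0 : R).
  apply: cvg_series_cvg_0; apply: nondecreasing_is_cvgn.
    apply/nondecreasing_seqP => n; rewrite /series /= big_nat_recr //= lerDl.
    exact: sqr_ge0.
  exists C => _ [n _ <-]; rewrite /series /= big_mkord; exact: yC.
apply/cvgrPdist_lt => /= e e0.
have e20 : 0 < e ^+ 2 by rewrite exprn_gt0.
have /cvgrPdist_lt /(_ _ e20) := y2; apply: filterS => k /=.
rewrite !sub0r !normrN normrX ltr_pXn2r // ?nnegrE //; exact: ltW.
Qed.

(** The sum of the squares has a finite mean, so it is almost surely finite. *)
Lemma ae_cvg0_of_sum_second_moments (R : realType) (d : measure_display)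
    (T : measurableType d) (P : probability T R) (Y : nat -> T -> R)
    (V : nat -> R) (C : R) :
  (forall k, measurable_fun setT (Y k)) ->
  (forall k, (\int[P]_w (Y k w ^+ 2)%:E = (V k)%:E)%E) ->
  (forall n, \sum_(k < n) V k <= C) ->
  {ae P, forall w, Y k w @[k --> \oo] --> (0 : R)}.
Proof.
move=> mY VY VC.
pose f k w := (Y k w ^+ 2)%:E : \bar R.
have f0 k w : (0 <= f k w)%E by rewrite lee_fin sqr_ge0.
have mf k : measurable_fun setT (f k).
  apply/measurable_EFinP; exact: measurable_funX.
pose S w := (\sum_(0 <= k <oo) f k w)%E.
have S0 w : (0 <= S w)%E by apply: nneseries_ge0.
have intS : P.-integrable setT S.
  apply/integrableP; split.
    exact: ge0_emeasurable_sum.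
  rewrite (eq_integral S); last by move=> w _; rewrite gee0_abs.
  rewrite integral_nneseries //.
  apply: (@le_lt_trans _ _ C%:E); last exact: ltry.
  apply: lime_le.
    by apply: is_cvg_nneseries => n _ _; apply: integral_ge0.
  apply: nearW => n; rewrite (eq_bigr (fun k => (V k)%:E)); last by move=> k _; apply: VY.
  by rewrite sumEFin lee_fin big_mkord.
have := integrable_ae measurableT intS; apply: filterS => w /(_ I) Sfin.
apply: (@cvg0_of_summable_square _ _ (fine (S w))) => n.
rewrite -lee_fin fineK // -sumEFin -(big_mkord xpredT (fun k => f k w)).
exact: nneseries_lim_ge.
Qed.

Lemma discrete_measurable_fun (d d' : measure_display) (T : measurableType d)
    (U : measurableType d') (h : T -> nat) (F : nat -> U) :
  measurable_fun setT h -> measurable_fun setT (fun w => F (h w)).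
Proof.
move=> mh _ B mB; rewrite setTI.
by have := mh measurableT (F @^-1` B) I; rewrite setTI.
Qed.

Section Heights.
Context (R : realType) (d : measure_display) (T : measurableType d)
  (P : probability T R) (b1 b2 : nat -> nat -> R)
  (top right : nat -> nat -> {RV P >-> bool}).
Context (hS6V : stochastic_six_vertex b1 b2 top right).

Lemma measurable_height x y :
  measurable_fun setT (fun w => s6v_height right w x y).
Proof.
case: x => [|x]; first exact: measurable_cst.
elim: y => [|y IH].
  rewrite (_ : (fun w => _) = cst 0%N); first exact: measurable_cst.
  by apply/funext => w; rewrite /s6v_height big_nil.
rewrite (_ : (fun w => _) =
    fun w => (s6v_height right w x.+1 y + right x.+1 y.+1 w)%N); last first.
  by apply/funext => w; rewrite /s6v_height big_nat_recr.
apply: measurable_fun_addn => // _ B mB; rewrite setTI.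
rewrite (_ : _ @^-1` B = right x.+1 y.+1 @^-1` (nat_of_bool @^-1` B)) //.
exact: measurable_funPTI.
Qed.

Lemma integral_height (F : nat -> R) x y : (forall n, 0 <= F n) ->
  (\int[P]_w (F (s6v_height right w x y))%:E = (height_mean b1 b2 F x y)%:E)%E.
Proof.
move=> F0; rewrite /height_mean.
rewrite -(@integral_sample_box _ _ _ _ _ _ _ _ hS6V x y (fun c => F (height c x y))) //.
- apply: eq_integral => w _; congr (F _)%:E; symmetry.
  exact: sample_height.
- move=> c c' h; congr F; apply: eq_bigr => j _; rewrite h //=.
  by rewrite leqnn ltn_ord.
- rewrite (_ : _ \o _ = fun w => (F (s6v_height right w x y))%:E).
    apply: (@discrete_measurable_fun _ _ _ _ _ (fun n => (F n)%:E)).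
    exact: measurable_height.
  by apply/funext => w; rewrite /= sample_height.
Qed.

(** Conservation of lines holds almost surely only, since the sampling rule merely
gives probability 0 to the outputs that violate it. *)
Lemma ae_height_lipx x y : {ae P, forall w,
  (s6v_height right w x.+1 y <= s6v_height right w x y <=
   (s6v_height right w x.+1 y).+1)%N}.
Proof.
pose ok m n := (m <= n <= m.+1)%N.
pose f w : R := (~~ ok (s6v_height right w x.+1 y) (s6v_height right w x y))%:R.
have mf : measurable_fun setT (fun w => (f w)%:E).
  have mok : measurable_fun setT
      (fun w => ok (s6v_height right w x.+1 y) (s6v_height right w x y)).
    apply: measurable_and; apply: measurable_fun_leq; try exact: measurable_height.
    apply: (@discrete_measurable_fun _ _ _ _ _ S); exact: measurable_height.
  move=> _ B mB; rewrite setTI.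
  by have := mok measurableT [set b : bool | B (~~ b)%:R%:E] I; rewrite setTI.
have int0 : (\int[P]_w `|(f w)%:E| = 0)%E.
  pose phi c : R := (~~ ok (height c x.+1 y) (height c x y))%:R.
  rewrite (eq_integral (fun w => (phi (sample top right w))%:E)); last first.
    move=> w _; rewrite gee0_abs ?lee_fin ?ler0n //.
    by rewrite /phi !sample_height.
  rewrite (@integral_sample_box _ _ _ _ _ _ _ _ hS6V x.+1 y phi (fun _ _ => (true, true))).
  - congr EFin; rewrite -[RHS](expect_cst (bit_weight1 b1 b2) (rect 0 0 x.+1 y)
      0 (fun _ _ => (true, true))).
    by apply: eq_expect => u; rewrite /= /phi /ok step_height_lipx.
  - by move=> c; rewrite /phi ler0n.
  - move=> c c' h; rewrite /phi; congr (~~ ok _ _)%:R; apply: eq_bigr => j _.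
      by rewrite h //= leqnn ltn_ord.
    by rewrite h //= leqnSn ltn_ord.
  - rewrite (_ : _ \o _ = fun w => (f w)%:E) //.
    by apply/funext => w; rewrite /= /phi !sample_height.
have := (ae_eq_integral_abs _ measurableT mf).1 int0.
apply: filterS => w /(_ I) /eqP; rewrite /f eqe pnatr_eq0 eqb0 negbK; exact.
Qed.

End Heights.

(** * The limit shape *)

Section Periodic.
Context (R : realType) (b1 b2 : nat -> nat -> R).
Context (hb : forall i j : nat, (0 < i)%N -> (0 < j)%N ->
            0 <= b1 i j <= 1 /\ 0 <= b2 i j <= 1).
Context (I J : nat)
  (hper : forall i j : nat, (0 < i)%N -> (0 < j)%N ->
              [/\ b1 (i + I)%N j = b1 i j, b1 i (j + J)%N = b1 i j,
                  b2 (i + I)%N j = b2 i j & b2 i (j + J)%N = b2 i j]).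

Local Notation mean := (height_mean b1 b2 (fun k => k%:R)).
Local Notation mean2 := (height_mean b1 b2 (fun k => k%:R ^+ 2)).

Lemma bit_weight_periodic p q v : interior v ->
  bit_weight b1 b2 (p * I + v.1, q * J + v.2)%N = bit_weight b1 b2 v.
Proof.
case: v => i j /andP[/= i0 j0].
have perI k l : (0 < l)%N ->
    b1 (k * I + i)%N l = b1 i l /\ b2 (k * I + i)%N l = b2 i l.
  move=> l0; elim: k => // k [<- <-].
  have [|//|e _ e' _] := @hper (k * I + i)%N l; first by rewrite ltn_addl.
  by rewrite mulSn -addnA addnC e e'.
have perJ k : b1 i (k * J + j)%N = b1 i j /\ b2 i (k * J + j)%N = b2 i j.
  elim: k => // k [<- <-].
  have [//||_ e _ e'] := @hper i (k * J + j)%N; first by rewrite ltn_addl.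
  by rewrite mulSn -addnA addnC e e'.
apply/funext => b; rewrite /bit_weight /=.
have [|-> ->] := perI p (q * J + j)%N; first by rewrite ltn_addl.
by have [-> ->] := perJ q.
Qed.

Lemma mean_lattice_lip x y :
  `|mean x.+1 y - mean x y| <= 1 /\ `|mean x y.+1 - mean x y| <= 1.
Proof.
have /andP[h1 h2] := height_mean_lipx hb x y.
have /andP[h3 h4] := height_mean_lipy hb x y.
by rewrite !ler_norml; split; lra.
Qed.

(** The summands are the variances of the heights along a dyadic ray, divided by
4 ^ k; see the recursion V_(k + 1) + A_(k + 1) <= V_k / 2 + A_k in the
introduction. *)
Lemma sum_variance_le p q n :
  \sum_(k < n) height_mean b1 b2 (fun m =>
     ((m%:R - mean (2 ^ k * (p * I)) (2 ^ k * (q * J))) / 2 ^+ k) ^+ 2)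
       (2 ^ k * (p * I)) (2 ^ k * (q * J)) <=
  2 * mean2 (p * I)%N (q * J)%N.
Proof.
pose X k := (2 ^ k * (p * I))%N; pose Y k := (2 ^ k * (q * J))%N.
pose V k := (mean2 (X k) (Y k) - mean (X k) (Y k) ^+ 2) / 4 ^+ k.
pose A k := mean (X k) (Y k) ^+ 2 / 4 ^+ k.
have p4 k : 0 < 4 ^+ k :> R by rewrite exprn_gt0.
have V0 k : 0 <= V k.
  rewrite divr_ge0 ?(ltW (p4 k)) // -height_variance.
  by apply: height_mean_ge0 => // m; apply: sqr_ge0.
have A0 k : 0 <= A k by rewrite divr_ge0 ?sqr_ge0 // ltW.
have VE k : height_mean b1 b2 (fun m =>
    ((m%:R - mean (X k) (Y k)) / 2 ^+ k) ^+ 2) (X k) (Y k) = V k.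
  rewrite /V -height_variance mulrC /height_mean -expectZ.
  have sq2 : (2 ^+ k) ^+ 2 = 4 ^+ k :> R by rewrite -exprM mulnC exprM -natrX.
  by apply: eq_expect => u; rewrite expr_div_n sq2 mulrC.
rewrite (eq_bigr (fun k : 'I_n => V k)); last by move=> k _; apply: VE.
have step k : V k.+1 + A k.+1 <= V k / 2 + A k.
  rewrite /V /A -mulrDl subrK.
  have XE : X k.+1 = (X k + X k)%N by rewrite /X expnS -mulnA mul2n addnn.
  have YE : Y k.+1 = (Y k + Y k)%N by rewrite /Y expnS -mulnA mul2n addnn.
  have := @height_mean2_subadd _ _ _ hb (X k) (Y k) (X k) (Y k) _.
  rewrite -XE -YE /X /Y !(mulnA (2 ^ k)%N) => /(_ (bit_weight_periodic _ _)).
  rewrite -!(mulnA (2 ^ k)%N) -/(X k) -/(Y k) -/(X k.+1) -/(Y k.+1).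
  rewrite exprS invfM mulrA => h.
  rewrite [leRHS](_ : _ =
    (mean2 (X k) (Y k) + mean (X k) (Y k) ^+ 2) / 2 / 4 ^+ k); last by field; rewrite gt_eqF.
  rewrite ler_pM2r ?invr_gt0 //; lra.
have := sum_of_halving_le V0 A0 step n.
by rewrite /V /A -mulrDl subrK expr0 divr1 /X /Y !mul1n.
Qed.

End Periodic.

Theorem theorem1p2 (R : realType) (b1 b2 : nat -> nat -> R)
    (hb : forall i j : nat, (0 < i)%N -> (0 < j)%N ->
            0 <= b1 i j <= 1 /\ 0 <= b2 i j <= 1)
    (hper : exists I J : nat, [/\ (0 < I)%N, (0 < J)%N
          & forall i j : nat, (0 < i)%N -> (0 < j)%N ->
              [/\ b1 (i + I)%N j = b1 i j, b1 i (j + J)%N = b1 i j,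
                  b2 (i + I)%N j = b2 i j & b2 i (j + J)%N = b2 i j]])
    (d : measure_display) (T : measurableType d) (P : probability T R)
    (top right : nat -> nat -> {RV P >-> bool})
    (hS6V : stochastic_six_vertex b1 b2 top right) :
  exists g : R * R -> R,
    [lipschitz g p | p in [set p : R * R | 0 <= p.1 /\ 0 <= p.2]] /\
    {ae P, forall w : T, forall x y : R, 0 <= x -> 0 <= y ->
      (s6v_height right w (Num.truncn (n%:R * x)) (Num.truncn (n%:R * y)))%:R
        / n%:R @[n --> \oo] --> g (x, y)}.
Proof.
have [I [J [I0 J0 per]]] := hper.
pose a := height_mean b1 b2 (fun k => k%:R).
have a0 x y : 0 <= a x y by apply: height_mean_ge0.
have a_lip x y : `|a x.+1 y - a x y| <= 1 /\ `|a x y.+1 - a x y| <= 1.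
  exact: mean_lattice_lip.
have a_sub p q x y :
    a (p * I + x)%N (q * J + y)%N <= a (p * I)%N (q * J)%N + a x y.
  by apply: height_mean_subadd => // v; apply: bit_weight_periodic.
exists (scaling_limit a); split; first exact: (scaling_limit_lipschitz I0 J0).
pose D w x y : R := (s6v_height right w x y)%:R - a x y.
have dyadic p q : {ae P, forall w,
    D w (2 ^ k * (p * I))%N (2 ^ k * (q * J))%N / 2 ^+ k @[k --> \oo] --> (0 : R)}.
  apply: (@ae_cvg0_of_sum_second_moments _ _ _ P _ (fun k => height_mean b1 b2
      (fun m => ((m%:R - a (2 ^ k * (p * I))%N (2 ^ k * (q * J))%N) / 2 ^+ k) ^+ 2)
        (2 ^ k * (p * I)) (2 ^ k * (q * J)))
    (2 * height_mean b1 b2 (fun k => k%:R ^+ 2) (p * I) (q * J))).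
  - move=> k; apply: (@discrete_measurable_fun _ _ _ _ _
      (fun m => (m%:R - a (2 ^ k * (p * I))%N (2 ^ k * (q * J))%N) / 2 ^+ k)).
    exact: measurable_height.
  - move=> k; rewrite -(integral_height hS6V) // => m; exact: sqr_ge0.
  - by move=> n; apply: sum_variance_le.
have all_dyadic : {ae P, forall w, forall p q,
    D w (2 ^ k * (p * I))%N (2 ^ k * (q * J))%N / 2 ^+ k @[k --> \oo] --> (0 : R)}.
  by apply/ae_foralln => p; apply/ae_foralln => q; apply: dyadic.
have all_lip : {ae P, forall w, forall x y,
    (s6v_height right w x.+1 y <= s6v_height right w x y <=
     (s6v_height right w x.+1 y).+1)%N}.
  apply/ae_foralln => x; apply/ae_foralln => y; exact: (ae_height_lipx hS6V).
apply: filterS2 all_dyadic all_lip => w wdy wlip x y x0 y0.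
have D_lip u v : `|D w u.+1 v - D w u v| <= 2 /\ `|D w u v.+1 - D w u v| <= 2.
  have := a_lip u v; rewrite !ler_norml => -[/andP[h1 h2] /andP[h3 h4]].
  have /andP[] := wlip u v; rewrite -!(ler_nat R) -natr1 => h5 h6.
  have /andP[] := height_lipy (sample top right w) u v.
  rewrite !sample_height -!(ler_nat R) -natr1 => h7 h8.
  by rewrite /D; split; lra.
pose X n := Num.truncn (n%:R * x); pose Y n := Num.truncn (n%:R * y).
pose c := ((Num.truncn x).+1 + (Num.truncn y).+1)%N.
have Xc n : (X n <= c * n)%N.
  by rewrite mulnDl (leq_trans (truncn_mulrn n x0)) ?leq_addr.
have Yc n : (Y n <= c * n)%N.
  by rewrite mulnDl (leq_trans (truncn_mulrn n y0)) ?leq_addl.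
have lim0 := dyadic_interpolation D_lip I0 J0 wdy Xc Yc.
have lim1 := scaling_limit_cvg I0 J0 a0 a_lip a_sub x0 y0.
rewrite (_ : (fun n => _) = fun n => D w (X n) (Y n) / n%:R + a (X n) (Y n) / n%:R).
  by rewrite -[scaling_limit _ _]add0r; apply: cvgD.
by apply/funext => n; rewrite -mulrDl subrK.
Qed.
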